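(* Let $\{S(t): t\in[0,\infty)\}$ be an asymptotically closed semigroup on a complete metric space $(V,d)$, $\mathbf{B}$ be a bounded absorbing set, $T>0$ and assume that the covering condition $$N^{V}(S(kT)\mathbf{B},aq^{k})\le b h^{k},\quad k\in\mathbb{N},\ k\ge k_0,$$ holds with some $k_0\in\mathbb{N}$, $q\in(0,1)$, $a,b>0$ and $h\ge1$. Assume further that there exist $T_2>T_1\ge0$, $\zeta>0$ and $\nu>0$ such that $$d(S(t_1)x,S(t_2)x)\le\zeta|t_1-t_2|^{\nu},\quad t_1,t_2\in[T_1,T_2],\ x\in\mathbf{B}.$$ If $T_1>0$, then also assume that for some $N\in\mathbb{N}$ such that $NT\ge T_1$ $$d(S(NT)x,S(NT)y)\le L_N d(x,y),\quad x,y\in\mathbf{B},$$ holds with some $L_N\ge0$. Then there exists an exponential attractor $\mathbf{M}$ (which can be chosen independently of $\nu$, $\zeta$, $T_2$) with rate of attraction $\xi\in(0,\frac1T\ln\frac1q)$, and its fractal dimension is bounded by $$\dim_f^{V}(\mathbf{M})\le\tfrac{1}{\nu}+\log_{\frac1q}h.$$ Moreover, $$\mathbf{M}=\mathbf{A}\cup\mathbf{E}=\mathrm{cl}_V\mathbf{E}\subseteq\mathbf{B},$$ where $\mathbf{E}=\bigcup_{t\in I}S(t)\mathbf{E_0}\subseteq\mathbf{B}$ for some compact interval $I\subset[0,\infty)$, $\mathbf{E_0}\subseteq\mathbf{B}$ is the countable set described in the context, and $\mathbf{A}=\Lambda^V(\mathrm{cl}_V\mathbf{E_0})$ is the global attractor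 for the semigroup.
   Context: $\mathbb{N}=\{1,2,\dots\}$. Metric spaces are nonempty. A semigroup $\{S(t):t\in[0,\infty)\}$ on $(V,d)$ is a family of maps $S(t):V\to V$ with $S(t)S(s)=S(t+s)$ for $t,s\ge0$ and $S(0)=I$. Asymptotically closed: for any $t\ge 0$, $t_k\ge 0$ with $t_k\to\infty$ and any bounded sequence $x_k\in V$, if $S(t_k)x_k\to x$ and $S(t+t_k)x_k\to y$ with $x,y\in V$, then $S(t)x=y$. Absorbing set: $\mathbf{B}\subseteq V$ such that for every bounded $G\subseteq V$ there is $t_G\ge 0$ with $S(t)G\subseteq\mathbf{B}$ for all $t\ge t_G$. $\mathrm{dist}^V(G,H)=\sup_{x\in G}\inf_{y\in H}d(x,y)$; $\mathrm{cl}_V$ is closure in $V$; $\Lambda^V(G)=\bigcap_{s\ge0}\mathrm{cl}_V\bigcup_{t\ge s}S(t)G$. $N^V(G,\varepsilon)$ is the minimal number of open $\varepsilon$-balls in $V$ centered at points of $G$ needed to cover $G$; $\dim_f^V(G)=\limsup_{\varepsilon\to0^+}\log_{1/\varepsilon}N^V(G,\varepsilon)$. Global attractor: a nonempty compact set $\mathbf{A}\subseteq V$ with $S(t)\mathbf{A}=\mathbf{A}$ for all $t\ge 0$ and $\lim_{t\to\infty}\mathrm{dist}^V(S(t)G,\mathbf{A})=0$ for every bounded $G\subseteq V$. Exponential attractor: a nonempty compact set $\mathbf{M}\subseteq V$ with $S(t)\mathbf{M}\subseteq\mathbf{M}$ for all $t\ge0$, $\dim_f^V(\mathbf{M})<\infty$,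 and such that there is $\xi>0$ with $\lim_{t\to\infty}e^{\xi t}\mathrm{dist}^V(S(t)G,\mathbf{M})=0$ for every bounded $G\subseteq V$. ''With rate of attraction $\xi\in(0,\xi_0)$'' means that this limit holds for every $\xi\in(0,\xi_0)$ and every bounded $G$. The set $\mathbf{E_0}$: let $t_{\mathbf{B}}\ge0$ be such that $S(t)\mathbf{B}\subseteq\mathbf{B}$ for all $t\ge t_{\mathbf{B}}$, and let $\mathbf{B}'=\bigcup_{t\ge t_{\mathbf{B}}}S(t)\mathbf{B}\subseteq\mathbf{B}$, a positively invariant bounded absorbing set that satisfies the same covering condition with $a$ replaced by some larger $a'>0$ (if $\mathbf{B}$ itself is positively invariant, i.e. $S(t)\mathbf{B}\subseteq\mathbf{B}$ for all $t\ge0$, take $\mathbf{B}'=\mathbf{B}$). For $k\ge k_0$ choose finite sets $W_k\subseteq S(kT)\mathbf{B}'$ with $\#W_k\le bh^k$ and $S(kT)\mathbf{B}'\subseteq\bigcup_{x\in W_k}B^V(x,a'q^k)$ (open balls). Set $Q_{k_0}=W_{k_0}$, $Q_k=W_k\cup S(T)Q_{k-1}$ for $k>k_0$, and $\mathbf{E_0}=\bigcup_{k\ge k_0}Q_k$. *)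

(* Defs.v *)
From HB Require Import structures.
From mathcomp Require Export all_boot all_order all_algebra finmap.
From mathcomp Require Export all_classical all_reals all_analysis.

Set Implicit Arguments.
Unset Strict Implicit.
Unset Printing Implicit Defensive.

Export Order.TTheory GRing.Theory Num.Theory.
Export numFieldNormedType.Exports.

Local Open Scope classical_set_scope.
Local Open Scope ring_scope.

(* [Complete] includes [isPointed], so these spaces are nonempty. *)
#[short(type="completeMetricType")]
HB.structure Definition CompleteMetric (R : numDomainType) :=
  { V of Complete V & Metric R V }.

Section metric_notions.
Context {R : realType} {V : metricType R}.
Implicit Types (G H : set V) (e : R).

Definition mbounded G := exists (x : V) (r : R), G `<=` ball x r.

(* The supremum is taken in [0, +oo], so that the empty set is at distance 0
   from every set (the ereal_sup of set0 alone would be -oo). *)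
Definition semidist G H : \bar R :=
  maxe 0%E (ereal_sup
    [set ereal_inf [set (mdist x y)%:E | y in H] | x in G]).

(* The value is +oo when G has no finite cover by such balls. *)
Definition cover_num G e : \bar R :=
  ereal_inf [set (#|` A|%:R)%:E | A in [set A : {fset V} |
    [set` A] `<=` G /\ G `<=` \bigcup_(x in [set` A]) ball x e]].

Definition fractal_dim G : \bar R :=
  limf_esup (fun e : R => (lne (cover_num G e) * ((ln e^-1)^-1)%:E)%E) (0^'+).

End metric_notions.

(* Semigroups are indexed by R; only the maps S t with 0 <= t are meaningful,
   and every definition below only constrains or uses those. *)
Section semigroups.
Context {R : realType} {V : metricType R}.
Implicit Types (S : R -> V -> V) (A B G M : set V).

Definition semigroup S :=
  (forall x, S 0 x = x) /\
  (forall t s, 0 <= t -> 0 <= s -> forall x, S t (S s x) = S (t + s) x).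

Definition asymptotically_closed S :=
  forall (t : R) (tk : nat -> R) (xk : nat -> V) (x y : V),
    0 <= t -> (forall k, 0 <= tk k) -> tk k @[k --> \oo] --> +oo ->
    mbounded (range xk) ->
    S (tk k) (xk k) @[k --> \oo] --> x ->
    S (t + tk k) (xk k) @[k --> \oo] --> y ->
    S t x = y.

Definition positively_invariant S G :=
  forall t, 0 <= t -> S t @` G `<=` G.

Definition absorbing S B :=
  forall G, mbounded G ->
    exists tG, 0 <= tG /\ forall t, tG <= t -> S t @` G `<=` B.

Definition omega_limit S G : set V :=
  \bigcap_(s in [set s : R | 0 <= s])
    closure (\bigcup_(t in [set t : R | s <= t]) S t @` G).

Definition global_attractor S A :=
  [/\ A !=set0, compact A, (forall t, 0 <= t -> S t @` A = A) &
      forall G, mbounded G ->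
        semidist (S t @` G) A @[t --> +oo%R] --> 0%E].

Definition attracts_at_rate S M (xi : R) :=
  forall G, mbounded G ->
    ((expR (xi * t))%:E * semidist (S t @` G) M)%E @[t --> +oo%R] --> 0%E.

Definition exponential_attractor S M :=
  [/\ M !=set0, compact M, positively_invariant S M,
      (fractal_dim M < +oo)%E &
      exists xi : R, 0 < xi /\ attracts_at_rate S M xi].

End semigroups.

Section discrete_skeleton.
Context {R : realType} {V : metricType R}.
Variables (S : R -> V -> V) (B : set V) (T : R) (k0 : nat) (q a b h : R).

Definition reduced_absorbing (B' : set V) :=
  (exists tB, [/\ 0 <= tB, (forall t, tB <= t -> S t @` B `<=` B) &
     B' = \bigcup_(t in [set t : R | tB <= t]) S t @` B]) /\
  (positively_invariant S B -> B' = B).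

(* [skeleton W j] is Q_(k0 + j). *)
Fixpoint skeleton (W : nat -> {fset V}) (j : nat) : set V :=
  match j with
  | 0%N => [set` W k0]
  | j'.+1 => [set` W (k0 + j)%N] `|` S T @` skeleton W j'
  end.

(* E0 is the set produced by some admissible choice of B', a' and (W_k).
   The case a' = a is allowed, since it occurs when B' = B. *)
Definition is_E0 (E0 : set V) :=
  exists (B' : set V) (a' : R) (W : nat -> {fset V}),
    [/\ reduced_absorbing B', a <= a',
        (forall k, (k0 <= k)%N ->
          [/\ [set` W k] `<=` S (k%:R * T) @` B',
              #|` W k|%:R <= b * h ^+ k &
              S (k%:R * T) @` B' `<=`
                \bigcup_(x in [set` W k]) ball x (a' * q ^+ k)]) &
        E0 = \bigcup_j skeleton W j].

End discrete_skeleton.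

(* Main.v *)
Require Import Defs.
From mathcomp Require Import lra ring zify.

(* Let B' be the positively invariant absorbing set and W_k the nets of
   S(kT)B'.  Every S(t) maps S(kT)B' into itself, so outside finitely many orbit
   segments the flow E of the skeleton E0 over a period stays within S(kT)B',
   which W_k covers by b h^k balls of radius a' q^k; the finitely many segments
   are covered by sampling time with step ~ q^(k/nu), thanks to the Hölder
   condition.  This gives about k^2 (h / q^(1/nu))^k balls of radius ~ q^k, hence
   the bound on the dimension.

   The same covers make orbits asymptotically compact, so that Λ(B') is the
   global attractor; it lies in cl E0 because it equals S(kT) of itself, and
   invariance then identifies it with Λ(cl E0).  A point of cl E outside E is a
   limit of points of S(kT)B' for every k, since the orbit segments are compact:
   hence cl E = A ∪ E.  Exponential attraction holds because S(c) is Lipschitz and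
   E contains S(c)W_k, c being a multiple of T that is at least T1. *)

Set Implicit Arguments.
Unset Strict Implicit.
Unset Printing Implicit Defensive.

Local Open Scope classical_set_scope.
Local Open Scope ring_scope.

(** * Finite covers by balls and covering numbers *)

Section coverings.
Context {R : realType} {V : metricType R}.
Implicit Types (G H : set V) (A : {fset V}) (e r : R).

(** Each ball that meets [G] is replaced by one of twice the radius centered at a point of [G]
    inside it; the other balls are dropped. This reconciles arbitrary centers with [cover_num],
    which admits only centers in the covered set. *)
Lemma recenter_cover G A e : G `<=` \bigcup_(x in [set` A]) ball x e ->
  exists A' : {fset V}, [/\ [set` A'] `<=` G, (#|` A'| <= #|` A|)%N &
    G `<=` \bigcup_(x in [set` A']) ball x (2 * e)].
Proof.
move=> GA.
have /choice[f fP] x : exists y, (G `&` ball x e !=set0) ->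
    G y /\ ball x e y.
  have [[y [Gy xy]]|nG] := pselect (G `&` ball x e !=set0).
    by exists y.
  by exists x.
exists [fset f x | x in A & `[< G `&` ball x e !=set0 >]]%fset; split.
- by move=> y /= /imfsetP[x /=]; rewrite !inE => /andP[_ /asboolP/fP[Gy _]] ->.
- apply: (leq_trans (leq_imfset_card _ _ _)).
  rewrite /= -[leqRHS]/(size (enum_fset A)).
  by rewrite size_filter count_size.
- move=> y Gy; have [x /= xA xy] := GA _ Gy.
  have ne : G `&` ball x e !=set0 by exists y.
  exists (f x) => /=.
    by apply/imfsetP; exists x => //=; rewrite !inE xA; apply/asboolP.
  have [_ xfx] := fP _ ne.
  by rewrite mulr2n mulrDl mul1r; apply: ball_triangle xy; apply: ball_sym.
Qed.

Lemma cover_num_le G A e : G `<=` \bigcup_(x in [set` A]) ball x e ->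
  (cover_num G (2 * e) <= (#|` A|%:R)%:E)%E.
Proof.
move=> /recenter_cover[A' [A'G cA' GA']].
apply: (@le_trans _ _ (#|` A'|%:R)%:E).
  by apply: ereal_inf_lbound; exists A'.
by rewrite lee_fin ler_nat.
Qed.

(** The infimum runs over natural numbers, so a least cardinality attains it; without any finite
    cover it would be [+oo], against the finite bound [r]. *)
Lemma cover_num_attained G e r : (cover_num G e <= r%:E)%E ->
  exists A : {fset V}, [/\ [set` A] `<=` G, #|` A|%:R <= r &
    G `<=` \bigcup_(x in [set` A]) ball x e].
Proof.
move=> Gr; pose P n := `[< exists A : {fset V}, [/\ [set` A] `<=` G,
  G `<=` \bigcup_(x in [set` A]) ball x e & #|` A| = n] >].
have [[n Pn]|nP] := pselect (exists n, P n); last first.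
  exfalso; move: Gr; rewrite leNgt => /negP; apply.
  rewrite (_ : cover_num G e = +oo%E) ?ltry//.
  rewrite /cover_num (_ : [set _ | _ in _] = set0) ?ereal_inf0//.
  rewrite -subset0 => x [A [AG GA] _]; apply: nP.
  by exists #|` A|; apply/asboolP; exists A.
have [m /asboolP[A [AG GA Am]] mmin] := ex_minnP (ex_intro _ n Pn).
exists A; split=> //; rewrite -lee_fin; apply: le_trans Gr.
apply: le_ereal_inf_tmp => _ [A' [A'G GA'] <-]; rewrite lee_fin ler_nat Am.
by apply: mmin; apply/asboolP; exists A'.
Qed.

Lemma cover_closure G A e r : e < r ->
  G `<=` \bigcup_(x in [set` A]) ball x e ->
  closure G `<=` \bigcup_(x in [set` A]) ball x r.
Proof.
rewrite -subr_gt0 => er GA y Gy.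
have [z [/GA[x xA xz] yz]] := Gy _ (nbhsx_ballx y _ er); exists x => //.
by rewrite -(subrKC e r); apply: ball_triangle xz (ball_sym yz).
Qed.

Definition totally_bounded G := forall e, 0 < e ->
  exists A : {fset V}, G `<=` \bigcup_(x in [set` A]) ball x e.

Lemma totally_bounded_closure G : totally_bounded G -> totally_bounded (closure G).
Proof.
move=> tG e e0; have [|A GA] := tG (e / 2); first by rewrite divr_gt0.
by exists A; apply: cover_closure GA; rewrite gtr_pMr// invf_lt1// ltr1n.
Qed.

End coverings.

(** * Total boundedness and compactness in complete spaces *)

Section completeness.
Context {R : realType} {V : completeMetricType R}.

(** An ultrafilter containing a finite union of balls contains one of them. Applied at every radius
    this makes it Cauchy, so completeness supplies a limit. *)
Lemma totally_bounded_compact (G : set V) :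
  totally_bounded G -> compact (closure G).
Proof.
move=> /totally_bounded_closure tG; rewrite compact_ultra => F FU FG.
have Fc : cauchy F.
  apply/cauchyP => e e0; have [A GA] := tG _ e0.
  apply: contrapT => /forallNP nF.
  have : F (\bigcap_(x in [set` A]) ~` ball x e).
    apply: filter_bigI => x _.
    by have [/(nF x)|] := in_ultra_setVsetC (ball x e) FU.
  move=> /(filterI FG)/filter_ex[y [/GA[x xA xy]]].
  by move=> /(_ _ xA).
have [p Fp] : exists p : V, F --> p by exists (lim F); exact: cauchy_cvg.
exists p; split=> //; apply: closed_closure => U pU.
by apply: (@filter_ex _ F); apply: filterI FG (Fp _ pU).
Qed.

(** [phi] need not be increasing: [k <= phi k] already gives [phi k --> \oo], which is all that
    later limits require. *)
Lemma cvg_subseq (u : nat -> V) : totally_bounded (range u) ->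
  exists (p : V) (phi : nat -> nat), (forall k, (k <= phi k)%N) /\
    u (phi k) @[k --> \oo] --> p.
Proof.
move=> /totally_bounded_compact/(_ (u @ \oo) _).
case=> [|p [_ up]].
  by apply: (@filterS _ \oo _ setT) => [n _|]; [apply: subset_closure; exists n
    |exact: filterT].
have /choice[phi phiP] k : exists n, (k <= n)%N /\ ball p k.+1%:R^-1 (u n).
  have [||_ [[n /= kn <-] pun]] := up [set u n | n in [set n | (k <= n)%N]]
    (ball p k.+1%:R^-1).
  - by apply: filterS (nbhs_infty_ge k) => n kn; exists n.
  - by apply: nbhsx_ballx; rewrite invr_gt0.
  by exists n.
exists p, phi; split=> [k|]; first by have [] := phiP k.
apply/cvg_ballP => e e0.
near=> k; have [_] := phiP k; apply: le_ball; apply/ltW.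
by near: k; exact: near_infty_natSinv_lt (PosNum e0).
Unshelve. all: by end_near. Qed.

End completeness.

(** * From covering counts to fractal dimension *)

Section box_dimension.
Context {R : realType}.

(** The left side is the logarithm of [C * j.+1%:R ^+ 2 * H ^+ j]. Half of [eta] pays for the
    polynomial factor, through the sublinearity of [ln], and half for the terms that do not grow
    with [l], collected in [c]. *)
Lemma log_growth_le (C H lam K eta : R) : 0 < lam -> 0 <= ln H -> 0 < eta ->
  exists l0 : R, forall (l : R) (j : nat), l0 <= l -> j%:R * lam <= l + K ->
    ln C + 2 * ln j.+1%:R + j%:R * ln H <= (ln H / lam + eta) * l.
Proof.
move=> lam0 H0 eta0; pose al := eta * lam / 4.
have al0 : 0 < al by rewrite divr_gt0 ?mulr_gt0.
pose c := ln C - 2 * ln al + ln H / lam * K + eta / 2 * (K + lam).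
exists (2 / eta * c) => l j cl jl.
have lnj : ln j.+1%:R <= al * j.+1%:R - ln al.
  rewrite lerBrDr -lnM ?posrE// mulrC; apply: ltW; apply: ln_sublinear.
  by rewrite mulr_gt0.
have Hj : j%:R * ln H <= ln H / lam * (l + K).
  by rewrite mulrAC ler_pdivlMr// mulrAC mulrC ler_wpM2l.
have etaj : 2 * (al * j.+1%:R) <= eta / 2 * (l + K + lam).
  rewrite -addn1 natrD /al; have : eta / 2 * (j%:R * lam) <= eta / 2 * (l + K).
    by rewrite ler_wpM2l// ltW// divr_gt0.
  rewrite (_ : 2 * _ = eta / 2 * (j%:R * lam) + eta / 2 * lam); last by field.
  by rewrite [eta / 2 * (_ + lam)]mulrDr lerD2r.
have {}cl : c <= eta / 2 * l.
  rewrite -ler_pdivrMl ?divr_gt0//; apply: le_trans cl.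
  by rewrite invf_div.
rewrite /c in cl; lra.
Qed.

(** A radius [e] is compared with the least suitable scale [r * q ^+ j]; then [j] grows like
    [ln e^-1 / ln q^-1], and the quadratic factor disappears in the limit. *)
Lemma fractal_dim_le {V : metricType R} (G : set V) (r q C H : R) :
  0 < r -> 0 < q -> q < 1 -> 0 < C -> 1 <= H ->
  (forall j, exists A : {fset V}, #|` A|%:R <= C * j.+1%:R ^+ 2 * H ^+ j /\
    G `<=` \bigcup_(x in [set` A]) ball x (r * q ^+ j)) ->
  (fractal_dim G <= (ln H / ln q^-1)%:E)%E.
Proof.
move=> r0 q0 q1 C0 H1 cov.
have H0 : 0 < H by apply: lt_le_trans H1.
have lam0 : 0 < ln q^-1 by rewrite ln_gt0// invf_gt1.
have lnH0 : 0 <= ln H by rewrite ln_ge0.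
apply/lee_addgt0Pr => eta eta0.
pose K := ln (2 * r) + ln q^-1.
have [l0 l0P] := log_growth_le C K lam0 lnH0 eta0.
(* The three bounds make [ln e^-1] positive, bring it into the range of the growth estimate, and
   make the [x] below nonnegative, so that truncation behaves as the floor. *)
pose l1 := Num.max 1 (Num.max l0 (- ln (2 * r))).
pose U := [set e : R | 0 < e /\ e < expR (- l1)].
apply: (@le_trans _ _ (ereal_sup
    [set (lne (cover_num G e) * ((ln e^-1)^-1)%:E)%E | e in U])).
  apply: ereal_inf_lbound; exists U => //=.
  near=> e; split; near: e; first exact: nbhs_right_gt.
  by apply: nbhs_right_lt; rewrite expR_gt0.
apply: ge_ereal_sup => _ [e [e0 el1] <-].
set l := ln e^-1.
have ll1 : l1 <= l.
  by rewrite /l lnV ?posrE// lerNr -ler_expR lnK ?posrE// ltW.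
have [l_ge1 l0l l2r] : [/\ 1 <= l, l0 <= l & - ln (2 * r) <= l].
  by move: ll1; rewrite /l1 !ge_max => /andP[-> /andP[-> ->]].
have l_gt0 : 0 < l by apply: lt_le_trans l_ge1.
pose x := (l + ln (2 * r)) / ln q^-1.
have x0 : 0 <= x by apply: divr_ge0; [rewrite -lerBlDr sub0r|exact: ltW].
(* From [x <= j] comes [2 * (r * q ^+ j) <= e], the 2 being the price of recentering; from
   [j <= x + 1] comes the upper bound on [j], whose excess is the summand [ln q^-1] of [K]. *)
pose j := (Num.truncn x).+1.
have jl : j%:R * ln q^-1 <= l + K.
  rewrite /K /j addrA -natr1 mulrDl mul1r lerD2r -ler_pdivlMr//.
  by have /andP[] := truncn_itv x0.
have je : 2 * (r * q ^+ j) <= e.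
  rewrite mulrA -ler_ln ?posrE ?mulr_gt0 ?exprn_gt0//.
  rewrite lnM ?posrE ?mulr_gt0 ?exprn_gt0// lnXn// -[ln q *+ j]mulr_natl.
  have : l + ln (2 * r) <= j%:R * ln q^-1.
    rewrite -ler_pdivrMr//; apply: ltW.
    by have /andP[_] := truncn_itv x0.
  rewrite /l !lnV ?posrE// mulrN; lra.
have [A [cA GA]] := cov j.
have cove : (cover_num G e <= (C * j.+1%:R ^+ 2 * H ^+ j)%:E)%E.
  rewrite -lee_fin in cA; apply: le_trans cA.
  rewrite -[e](@divfK _ 2)// mulrC; apply: cover_num_le.
  apply: subset_trans GA _ => y [z zA zy]; exists z => //.
  by apply: le_ball zy; rewrite ler_pdivlMr// mulrC.
have cov0 : (0 <= cover_num G e)%E.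
  by apply: le_ereal_inf_tmp => _ [A' _ <-]; rewrite lee_fin.
have M0 : 0 < C * j.+1%:R ^+ 2 * H ^+ j by rewrite !mulr_gt0 ?exprn_gt0.
apply: (@le_trans _ _ ((ln (C * j.+1%:R ^+ 2 * H ^+ j))%:E * (l^-1)%:E)%E).
  apply: lee_wpmul2r; first by rewrite lee_fin invr_ge0 ltW.
  rewrite -lne_EFin// lee_lne// in_itv/= leey andbT//.
  by rewrite lee_fin ltW.
rewrite -EFinM -EFinD lee_fin ler_pdivrMr//.
apply: le_trans (l0P l j l0l jl).
rewrite !lnM ?posrE ?mulr_gt0 ?exprn_gt0// !lnXn//.
by rewrite -[ln H *+ j]mulr_natl [2 * _]mulr_natl mulr2n.
Unshelve. all: by end_near. Qed.

End box_dimension.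

(** * Semidistance, boundedness and limits of sequences *)

Section semidistance.
Context {R : realType} {V : metricType R}.
Implicit Types (G H : set V).

Lemma semidist_ge0 G H : (0 <= semidist G H)%E.
Proof. by rewrite /semidist le_max lexx. Qed.

Lemma semidist_le G H (e : R) : 0 <= e ->
  (forall x, G x -> exists2 y, H y & mdist x y <= e) -> (semidist G H <= e%:E)%E.
Proof.
move=> e0 GH; rewrite /semidist ge_max lee_fin e0 /=.
apply: ge_ereal_sup => _ [x /GH[y Hy xye] <-].
apply: (@le_trans _ _ (mdist x y)%:E); last by rewrite lee_fin.
by apply: ereal_inf_lbound; exists y.
Qed.

Lemma cvge0_of_le (f : R -> \bar R) : (forall t, 0 <= f t)%E ->
  (forall e : R, 0 < e -> exists t0, forall t, t0 <= t -> (f t <= e%:E)%E) ->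
  f t @[t --> +oo] --> 0%E.
Proof.
move=> f0 fe; apply/fine_cvgP; split.
  have [t0 t0P] := fe 1 ltr01; near=> t.
  rewrite ge0_fin_numE//; apply: le_lt_trans (ltry 1); apply: t0P.
  by near: t; apply: nbhs_pinfty_ge; exact: num_real.
apply/cvgrPdist_le => e e0; have [t0 t0P] := fe e e0; near=> t.
have ft : (f t <= e%:E)%E
  by apply: t0P; near: t; apply: nbhs_pinfty_ge; exact: num_real.
rewrite sub0r normrN ger0_norm ?fine_ge0//.
rewrite -lee_fin fineK// ge0_fin_numE//; exact: le_lt_trans ft (ltry e).
Unshelve. all: by end_near. Qed.

Lemma mboundedS G H : G `<=` H -> mbounded H -> mbounded G.
Proof. by move=> GH [x [r Hr]]; exists x, r; apply: subset_trans Hr. Qed.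

Lemma mbounded_closure G : mbounded G -> mbounded (closure G).
Proof.
move=> [x [r Gr]]; exists x, (r + 1) => y Gy.
have [z [/Gr xz yz]] := Gy _ (nbhsx_ballx y _ ltr01).
exact: ball_triangle xz (ball_sym yz).
Qed.

Lemma closure_seq (x : V) (H : nat -> set V) :
  (forall k, closure (H k) x) ->
  exists2 u : nat -> V, (forall k, H k (u k)) & u k @[k --> \oo] --> x.
Proof.
move=> Hx; have /choice[u uP] k : exists y, H k y /\ ball x k.+1%:R^-1 y.
  have k0 : 0 < k.+1%:R^-1 :> R by rewrite invr_gt0.
  by have [y] := Hx k _ (nbhsx_ballx x _ k0); exists y.
exists u => [k|]; first by have [] := uP k.
apply/cvg_ballP => e e0; near=> k.
have [_] := uP k; apply: le_ball; apply/ltW.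
by near: k; exact: near_infty_natSinv_lt (PosNum e0).
Unshelve. all: by end_near. Qed.

Lemma cvg_subseq_infty (phi : nat -> nat) :
  (forall k, (k <= phi k)%N) -> phi k @[k --> \oo] --> \oo.
Proof.
move=> phik A [N _ NA]; exists N => //= k Nk; apply: NA => /=.
exact: leq_trans (phik k).
Qed.

End semidistance.

(** * The omega-limit set as global attractor *)

Section attractor.
Context {R : realType} {V : completeMetricType R}.
Variables (S : R -> V -> V) (B : set V).
Hypotheses (S_sg : semigroup S) (B_bounded : mbounded B)
  (B_absorbing : absorbing S B).

Lemma semigroup0 x : S 0 x = x.
Proof. by have [->] := S_sg. Qed.

Lemma semigroupD t s x : 0 <= t -> 0 <= s -> S (t + s) x = S t (S s x).
Proof. by move=> t0 s0; have [_ ->] := S_sg. Qed.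

Lemma absorbing_nonempty : B !=set0.
Proof.
have [|t [_ tP]] := B_absorbing (G := [set point]).
  by exists point, 1 => _ ->; exact: ballxx.
by exists (S t point); apply: (tP t) => //; exists point.
Qed.

Lemma invariant_sub_absorbing (A : set V) t0 : mbounded A ->
  (forall t, 0 <= t -> S t @` A = A) -> 0 <= t0 -> A `<=` S t0 @` B.
Proof.
move=> /B_absorbing[t [t_ge0 tP]] inv t00.
rewrite -{1}(inv _ (addr_ge0 t00 t_ge0)) => _ [x Ax <-].
by rewrite semigroupD//; exists (S t x) => //; apply: (tP t) => //; exists x.
Qed.

(** The offset [s] keeps the times above a prescribed bound, so that a fixed time can be subtracted
    from them. *)
Lemma omega_limit_seq G x s : 0 <= s -> omega_limit S G x ->
  exists (tk : nat -> R) (xk : nat -> V),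
    [/\ forall k, s + k%:R <= tk k, forall k, G (xk k) &
      S (tk k) (xk k) @[k --> \oo] --> x].
Proof.
move=> s0 Gx.
have [|u uP ux] := @closure_seq R V x (fun k =>
    \bigcup_(t in [set t : R | s + k%:R <= t]) S t @` G).
  by move=> k; apply: Gx; rewrite /= addr_ge0.
have /choice[w wP] k : exists p : R * V,
    [/\ s + k%:R <= p.1, G p.2 & u k = S p.1 p.2].
  by have [t /= st [y Gy <-]] := uP k; exists (t, y).
exists (fst \o w), (snd \o w); split=> [k|k|]; try by have [] := wP k.
rewrite (_ : (fun _ => _) = u)//; apply/funext => k /=.
by have [_ _ ->] := wP k.
Qed.

Lemma seq_omega_limit G (x : V) (tk : nat -> R) (xk : nat -> V) :
  tk k @[k --> \oo] --> +oo -> (forall k, G (xk k)) ->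
  S (tk k) (xk k) @[k --> \oo] --> x -> omega_limit S G x.
Proof.
move=> tkoo Gx Sx s s0.
apply: (@closed_cvg _ _ _ _ _ (closure _) (@closed_closure _ _) _ _ Sx).
near=> k; apply: subset_closure; exists (tk k); last by exists (xk k).
by near: k; move/cvgryPge: tkoo; apply.
Unshelve. all: by end_near. Qed.

Hypothesis S_compact : forall e, 0 < e -> exists s (A : {fset V}), 0 <= s /\
  S s @` B `<=` \bigcup_(x in [set` A]) ball x e.

Lemma orbit_subseq (tk : nat -> R) (xk : nat -> V) :
  tk k @[k --> \oo] --> +oo -> mbounded (range xk) ->
  exists (p : V) (phi : nat -> nat), phi k @[k --> \oo] --> \oo /\
    S (tk (phi k)) (xk (phi k)) @[k --> \oo] --> p.
Proof.
move=> tkoo xkb.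
suff /cvg_subseq[p [phi [phik up]]] :
    totally_bounded (range (fun k => S (tk k) (xk k))).
  by exists p, phi; split=> //; exact: cvg_subseq_infty.
move=> e e0; have [s [A [s0 sA]]] := S_compact e0.
have [t [t0 tP]] := B_absorbing xkb.
have [N _ NP] : \forall k \near \oo, s + t <= tk k by move/cvgryPge: tkoo; apply.
exists (A `|` [fset S (tk (val i)) (xk (val i)) | i : 'I_N])%fset.
move=> _ [k _ <-]; have [kN|Nk] := ltnP k N.
  exists (S (tk k) (xk k)); last exact: ballxx.
  by rewrite /= inE; apply/orP; right; apply/imfsetP; exists (Ordinal kN).
have stk : s + t <= tk k by apply: NP.
have [|x /= xA xy] := sA (S (tk k) (xk k)).
  exists (S (tk k - s) (xk k)); last first.
    rewrite -semigroupD ?subrKC// subr_ge0; apply: le_trans stk.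
    by rewrite lerDl.
  by apply: (tP (tk k - s)); [rewrite lerBrDl|exists (xk k) => //; exists k].
by exists x => //=; rewrite inE xA.
Qed.

Hypothesis S_closed : asymptotically_closed S.

Let attr := omega_limit S B.

Let attr_bounded : mbounded attr.
Proof.
have [t [t0 tP]] := B_absorbing B_bounded.
apply: mboundedS (mbounded_closure B_bounded) => x /(_ t t0).
by apply: closure_subset => y [s ts] /(tP _ ts).
Qed.

Let boundedB (xk : nat -> V) : (forall k, B (xk k)) -> mbounded (range xk).
Proof. by move=> Bx; apply: mboundedS B_bounded => _ [k _ <-]. Qed.

Let ge_cvgoo (tk : nat -> R) s : 0 <= s -> (forall k, s + k%:R <= tk k) ->
  tk k @[k --> \oo] --> +oo.
Proof.
move=> s0 stk; apply/cvgryPge => M; near=> k.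
apply: le_trans (stk k); apply: le_trans (_ : k%:R <= _); last by rewrite lerDr.
by near: k; exact: nbhs_infty_ger.
Unshelve. all: by end_near. Qed.

(** Asymptotic closedness replaces continuity of [S t]. For one inclusion a limit of
    [S (t + tk k) (xk k)] is extracted and must be [S t x]; for the other, a limit of
    [S (tk k - t) (xk k)] is the preimage sought. *)
Let attr_invariant t : 0 <= t -> S t @` attr = attr.
Proof.
move=> t0; apply/seteqP; split=> [_ [x Ax <-]|x Ax].
  have [tk [xk [tkk Bx Sx]]] := omega_limit_seq (lexx 0) Ax.
  have tkoo := ge_cvgoo (lexx 0) tkk.
  have tk0 k : 0 <= tk k by apply: le_trans (tkk k); rewrite add0r.
  have ttkoo : t + tk k @[k --> \oo] --> +oo.
    by apply: (ge_cvgoo t0) => k; rewrite lerD2l -[leLHS]add0r.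
  have [p [phi [phik Sp]]] := orbit_subseq ttkoo (boundedB Bx).
  suff -> : S t x = p.
    apply: (seq_omega_limit (tk := fun k => t + tk (phi k))) Sp => //.
    exact: (cvg_comp _ _ phik ttkoo).
  apply: (S_closed (tk := tk \o phi) (xk := xk \o phi)) Sp => //=.
  - exact: cvg_comp tkoo.
  - by apply: boundedB => k /=.
  - exact: (cvg_comp _ _ phik Sx).
have [tk [xk [tkk Bx Sx]]] := omega_limit_seq t0 Ax.
have tkoo : tk k - t @[k --> \oo] --> +oo.
  by apply: (ge_cvgoo (lexx 0)) => k; rewrite add0r lerBrDl.
have tk0 k : 0 <= tk k - t.
  by rewrite subr_ge0; apply: le_trans (tkk k); rewrite lerDl.
have [p [phi [phik Sp]]] := orbit_subseq tkoo (boundedB Bx).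
exists p.
  apply: (seq_omega_limit (tk := fun k => tk (phi k) - t)) Sp => //.
  exact: (cvg_comp _ _ phik tkoo).
apply: (S_closed (tk := fun k => tk (phi k) - t) (xk := xk \o phi)) Sp _ => //=.
- exact: (cvg_comp _ _ phik tkoo).
- by apply: boundedB => k /=.
- under eq_fun do rewrite subrKC; exact: (cvg_comp _ _ phik Sx).
Qed.

(** Otherwise there are points of the orbits of [G], at times tending to infinity, that stay farther
    than [e] from [attr]; a limit of a subsequence lies in [attr], a contradiction. *)
Let attr_attracts G e : mbounded G -> 0 < e -> exists t0, forall t x,
  t0 <= t -> G x -> exists2 y, attr y & mdist (S t x) y <= e.
Proof.
move=> Gb e0; have [tG [tG0 tGP]] := B_absorbing Gb.
apply: contrapT => /forallNP nG.
have /choice[w wP] k : exists p : R * V, [/\ tG + k%:R <= p.1, G p.2 &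
    forall y, attr y -> e < mdist (S p.1 p.2) y].
  have /existsNP[t /existsNP[x /not_implyP[tGt /not_implyP[Gx nA]]]] :=
    nG (tG + k%:R).
  exists (t, x); split => // y Ay; rewrite ltNge; apply/negP => xy.
  by apply: nA; exists y.
have wk k : tG + k%:R <= (w k).1 by have [] := wP k.
have woo := ge_cvgoo tG0 wk.
have wG k : G (w k).2 by have [] := wP k.
have wb : mbounded (range (snd \o w)) by apply: mboundedS Gb => _ [k _ <-] /=.
have [p [phi [phik Sp]]] := orbit_subseq woo wb.
(* The orbits start in [G], whereas [attr] is the omega-limit of [B]: spending the time [tG] first
   moves the starting points into [B]. *)
have Ap : attr p.
  apply: (seq_omega_limit (tk := fun k => (w (phi k)).1 - tG)
    (xk := fun k => S tG (w (phi k)).2)).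
  - apply: (cvg_comp _ (fun k => (w k).1 - tG) phik).
    by apply: (ge_cvgoo (lexx 0)) => k; rewrite add0r lerBrDl.
  - by move=> k; apply: (tGP tG) => //; exists (w (phi k)).2.
  - rewrite (_ : (fun _ => _) = fun k => S (w (phi k)).1 (w (phi k)).2)//.
    apply/funext => k; rewrite -semigroupD ?subrK//.
    by rewrite subr_ge0; apply: le_trans (wk _); rewrite lerDl.
have /cvg_ballP/(_ e e0)[N _ /(_ N (leqnn N))] := Sp.
rewrite /= ballEmdist /= metric_sym; apply/negP; rewrite -leNgt; apply: ltW.
by have [_ _] := wP (phi N); apply.
Qed.

Lemma omega_limit_global_attractor : global_attractor S (omega_limit S B).
Proof.
split=> //.
- have [b Bb] := absorbing_nonempty.
  have [||p [phi [phik Sp]]] := @orbit_subseq (fun k => k%:R) (fun=> b).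
  + by apply: (ge_cvgoo (lexx 0)) => k; rewrite add0r.
  + exact: boundedB.
  exists p; apply: (seq_omega_limit (tk := fun k => (phi k)%:R)) Sp => //.
  apply: (cvg_comp _ (fun k => k%:R) phik).
  by apply: (ge_cvgoo (lexx 0)) => k; rewrite add0r.
- have /closure_id clA : closed attr.
    by apply: closed_bigI => s _; exact: closed_closure.
  rewrite -/attr clA; apply: totally_bounded_compact => e e0.
  have [s [A [s0 sA]]] := S_compact e0; exists A.
  apply: subset_trans sA; exact: invariant_sub_absorbing.
- move=> G Gb; apply: cvge0_of_le => [t|e e0]; first exact: semidist_ge0.
  have [t0 t0P] := attr_attracts Gb e0.
  exists t0 => t t0t; apply: semidist_le => [|_ [x Gx <-]]; first exact: ltW.
  exact: t0P.
Qed.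

End attractor.

(** * Two elementary facts on real numbers *)

Lemma real_period_itv {R : realType} (T x : R) : 0 < T -> 0 <= x ->
  exists2 m : nat, m%:R * T <= x & x < m%:R * T + T.
Proof.
move=> T0 x0; have xT : 0 <= x / T by rewrite divr_ge0 // ltW.
have /andP[] := truncn_itv xT; rewrite ler_pdivlMr// ltr_pdivrMr//.
by rewrite -natr1 mulrDl mul1r; exists (Num.truncn (x / T)).
Qed.

Lemma powR_le1 {R : realType} (x s : R) : 0 <= x -> x <= 1 -> 0 <= s -> x `^ s <= 1.
Proof.
move=> x0 x1 s0; rewrite (_ : 1 = 1 `^ s); last by rewrite powR1.
by apply: ge0_ler_powR; rewrite ?nnegrE.
Qed.

(** * The skeleton: cardinalities, nets and invariance *)

Section skeleton_theory.
Context {R : realType} {V : completeMetricType R}.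
Variables (S : R -> V -> V) (P : set V) (T : R) (k0 : nat) (q r b h : R).
Variable W : nat -> {fset V}.
Hypotheses (S_sg : semigroup S) (P_inv : positively_invariant S P).
Hypotheses (T_gt0 : 0 < T) (q_gt0 : 0 < q) (q_lt1 : q < 1) (r_gt0 : 0 < r).
Hypotheses (b_gt0 : 0 < b) (h_ge1 : 1 <= h).
Hypothesis W_sub : forall k, (k0 <= k)%N -> [set` W k] `<=` S (k%:R * T) @` P.
Hypothesis W_card : forall k, (k0 <= k)%N -> #|` W k|%:R <= b * h ^+ k.
Hypothesis W_cover : forall k, (k0 <= k)%N ->
  S (k%:R * T) @` P `<=` \bigcup_(x in [set` W k]) ball x (r * q ^+ k).

Let Q := skeleton S T k0 W.
Let E0 := \bigcup_j Q j.

Let kT_ge0 k : 0 <= k%:R * T. Proof. by rewrite mulr_ge0// ltW. Qed.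

Lemma image_antitone s t : 0 <= s -> s <= t -> S t @` P `<=` S s @` P.
Proof.
move=> s0 st _ [x Px <-]; exists (S (t - s) x).
  by apply: (P_inv (t := t - s)); [rewrite subr_ge0|exists x].
by rewrite -semigroupD ?subr_ge0// subrKC.
Qed.

Lemma skeleton_sub j : Q j `<=` S ((k0 + j)%N%:R * T) @` P.
Proof.
elim: j => [|j IH]; first by rewrite addn0; exact: W_sub.
rewrite /Q /= => x [/W_sub|]; first by apply; exact: leq_addr.
move=> [y /IH[z Pz <-] <-]; exists z => //.
rewrite -semigroupD//; last exact: ltW.
by rewrite addnS -[in LHS]natr1 mulrDl mul1r addrC.
Qed.

(** Level [j] consists of [j.+1] sets, images of the nets [W (k0 + i)] with [i <= j]; as [1 <= h],
    each has at most [b * h ^+ (k0 + j)] points. *)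
Lemma skeleton_finite j : exists2 A : {fset V}, Q j = [set` A] &
  #|` A|%:R <= b * j.+1%:R * h ^+ (k0 + j).
Proof.
elim: j => [|j [A QA cA]].
  by exists (W k0) => //; rewrite addn0 mulr1 W_card.
exists (W (k0 + j.+1) `|` [fset S T x | x in A])%fset.
  rewrite /Q /= -/(Q j) QA; apply/seteqP; split=> x /=.
    move=> [xW|[y yA <-]]; rewrite inE; apply/orP; first by left.
    by right; apply/imfsetP; exists y.
  rewrite inE => /orP[xW|/imfsetP[y yA ->]]; first by left.
  by right; exists y.
apply: (@le_trans _ _ (#|` W (k0 + j.+1)|%:R + #|` A|%:R)).
  rewrite -natrD ler_nat; apply: leq_trans (leq_card_fsetU _ _) _.
  by rewrite leq_add2l leq_imfset_card.
rewrite -[in leRHS]natr1 mulrDr mulr1 mulrDl addrC; apply: lerD; last first.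
  by rewrite W_card// leq_addr.
apply: le_trans cA _; apply: ler_wpM2l; first by rewrite mulr_ge0 ?ltW.
by apply: ler_weXn2l => //; rewrite leq_add2l.
Qed.

Lemma skeleton_prefix_finite j :
  exists2 A : {fset V}, \bigcup_(i in `I_j) Q i = [set` A] &
    #|` A|%:R <= b * j.+1%:R ^+ 2 * h ^+ (k0 + j).
Proof.
elim: j => [|j [A QA cA]].
  exists fset0; first by rewrite II0 bigcup_set0 set_fset0.
  by rewrite cardfs0 !mulr_ge0 ?exprn_ge0 ?(ltW b_gt0)// (le_trans ler01).
have [A' QA' cA'] := skeleton_finite j.
exists (A `|` A')%fset.
  by rewrite IIS bigcup_setU QA bigcup_set1 QA' set_fsetU.
apply: (@le_trans _ _ (#|` A|%:R + #|` A'|%:R)).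
  by rewrite -natrD ler_nat leq_card_fsetU.
apply: le_trans (lerD cA cA') _; rewrite -mulrDl -mulrDr.
apply: ler_pM.
- by rewrite mulr_ge0// ltW.
- by rewrite exprn_ge0// (le_trans ler01).
(* The linear bounds of the levels add up to a quadratic one, by [(j+1)^2 + (j+1) <= (j+2)^2]. *)
- by rewrite ler_pM2l// -natrX -natrD -natrX ler_nat; nia.
- by apply: ler_weXn2l => //; rewrite leq_add2l.
Qed.

Lemma skeleton_union_split j :
  E0 `<=` (\bigcup_(i in `I_j) Q i) `|` S ((k0 + j)%N%:R * T) @` P.
Proof.
move=> x [i _ Qx]; have [ij|ji] := ltnP i j; first by left; exists i.
right; move/skeleton_sub: Qx; apply: image_antitone => //.
by rewrite ler_pM2r// ler_nat leq_add2l.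
Qed.

Lemma skeleton_union_sub : E0 `<=` P.
Proof. by move=> x [i _ /skeleton_sub]; apply: P_inv. Qed.

Lemma skeleton_union_countable : countable E0.
Proof.
apply: bigcup_countable => // j _; have [A -> _] := skeleton_finite j.
exact: countable_fset.
Qed.

Lemma skeleton_union_net k : (k0 <= k)%N -> [set` W k] `<=` E0.
Proof.
move=> k0k x xW; exists (k - k0)%N => //; rewrite /Q.
case E : (k - k0)%N => [|j] /=.
  by rewrite (_ : k0 = k)//; apply/eqP; rewrite eqn_leq k0k -subn_eq0 E.
by left; rewrite -E subnKC.
Qed.

Lemma skeleton_union_step m x : E0 x -> E0 (S (m%:R * T) x).
Proof.
move=> Ex; elim: m => [|m [j _ Qj]]; first by rewrite mul0r semigroup0.
exists j.+1 => //; right; exists (S (m%:R * T) x) => //.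
rewrite -semigroupD//; last exact: ltW.
by rewrite -natr1 mulrDl mul1r addrC.
Qed.

Lemma radius_cvg0 e : 0 < e -> exists2 k, (k0 <= k)%N & r * q ^+ k < e.
Proof.
move=> e0; have : q ^+ k @[k --> \oo] --> 0.
  by apply: cvg_expr; rewrite ger0_norm// ltW.
move=> /cvgrPdist_lt/(_ (e / r)); rewrite divr_gt0// => /(_ isT) nq.
near \oo => k; exists k; first by near: k; exact: nbhs_infty_ge.
rewrite -ltr_pdivlMl// mulrC -[ltLHS]ger0_norm ?exprn_ge0 1?ltW//.
by rewrite -normrN -[X in `|X|]add0r; near: k.
Unshelve. all: by end_near. Qed.

Lemma skeleton_totally_bounded e : 0 < e -> exists s (A : {fset V}), 0 <= s /\
  S s @` P `<=` \bigcup_(x in [set` A]) ball x e.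
Proof.
move=> /radius_cvg0[k k0k rqk]; exists (k%:R * T), (W k); split => //.
apply: subset_trans (W_cover k0k) _ => y [x Wx xy]; exists x => //.
by apply: le_ball xy; exact: ltW.
Qed.

(** * The flow of the skeleton over one period, and its attraction *)

Section flow.
Variable c : R.
Hypothesis c_ge0 : 0 <= c.
(** The interval is one period long, so that subtracting multiples of [T] brings any later time back
    into it; it starts at [c] because Lipschitz dependence on the point is assumed of [S c]. *)
Let E := \bigcup_(t in `[c, c + T]) S t @` E0.

(** A time past [c] is a time in [[c, c + T]] plus a multiple of [T], and [E0] absorbs the multiple
    because [S T] maps each level into the next. *)
Lemma flow_positively_invariant : positively_invariant S E.
Proof.
suff inv (t : R) : 0 <= t -> S t @` E `<=` E by [].
move=> t0 _ [_ [s /=] /[!in_itv]/= /andP[cs scT] [x Ex <-] <-].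
have s0 : 0 <= s by apply: le_trans cs.
have [|m mt tm] := @real_period_itv R T (t + s - c) T_gt0.
  by rewrite subr_ge0 -[leLHS]add0r lerD.
have lo : c <= t + s - m%:R * T by lra.
have up : t + s - m%:R * T <= c + T by lra.
rewrite -semigroupD//; exists (t + s - m%:R * T).
  by rewrite /= in_itv/= lo up.
exists (S (m%:R * T) x); first exact: skeleton_union_step.
by rewrite -semigroupD// ?subrK//; apply: le_trans lo.
Qed.

Lemma flow_sub : E `<=` P.
Proof.
move=> _ [t /=] /[!in_itv]/= /andP[ct _] [x /skeleton_union_sub Px <-].
by apply: (P_inv (t := t)); [exact: le_trans ct|exists x].
Qed.

Variable L : R.
Hypothesis L_ge0 : 0 <= L.
Hypothesis S_lip : forall x y, P x -> P y -> mdist (S c x) (S c y) <= L * mdist x y.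

(** [S c] moves the net [W k] into [E] and enlarges its error by at most the factor [L]. *)
Lemma flow_near k x : (k0 <= k)%N -> P x ->
  exists2 y, E y & mdist (S (c + k%:R * T) x) y <= L * (r * q ^+ k).
Proof.
move=> k0k Px;
have [|w Ww wx] := W_cover k0k (_ : (S (k%:R * T) @` P) (S (k%:R * T) x)).
  by exists x.
have Ew := skeleton_union_net k0k Ww.
exists (S c w).
  by exists c; [rewrite /= in_itv/= lexx lerDl ltW|exists w].
rewrite semigroupD//; apply: le_trans (S_lip _ _) _.
- by apply: (P_inv (kT_ge0 k)); exists x.
- exact: skeleton_union_sub.
- rewrite ler_wpM2l// metric_sym ltW//.
  by move: wx; rewrite ballEmdist.
Qed.

Lemma invariant_sub_closure_flow (A : set V) : A `<=` P ->
  (forall t, 0 <= t -> S t @` A = A) -> A `<=` closure E.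
Proof.
move=> AP inv x Ax U; rewrite -nbhs_ballE => -[e /= e0 xeU].
have [|k k0k rqk] := @radius_cvg0 (e / (L + 1)).
  by rewrite divr_gt0// ltr_wpDl.
have : (S (c + k%:R * T) @` A) x by rewrite inv// addr_ge0.
move=> [z /AP Pz zx]; rewrite -{}zx in xeU.
have [y Ey zy] := flow_near k0k Pz; exists y; split=> //; apply: xeU.
rewrite ballEmdist/=; apply: le_lt_trans zy _.
have L1 : 0 < L + 1 by rewrite ltr_wpDl.
rewrite ltr_pdivlMr// mulrC in rqk; apply: le_lt_trans rqk.
by rewrite ler_wpM2r ?lerDl// mulr_ge0 ?exprn_ge0// ltW.
Qed.

(** After entering [P] at [tG], an orbit spends the time [c] on the Lipschitz estimate and [k]
    periods on refining the net; [k] is the number of periods that fit into [t - t1]. *)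
Lemma flow_attracts (M : set V) xi : absorbing S P -> E `<=` M ->
  0 < xi -> xi < T^-1 * ln q^-1 -> attracts_at_rate S M xi.
Proof.
move=> P_abs EM xi0 xiq G /P_abs[tG [tG0 tGP]].
have xiT : xi * T < ln q^-1 by rewrite -ltr_pdivlMr// mulrC.
(* Per period the error shrinks by [q] while the weight grows by [expR (xi * T)]; [rho < 1] is the
   bound assumed on [xi]. *)
pose rho := expR (xi * T) * q.
have rho0 : 0 < rho by rewrite mulr_gt0 ?expR_gt0.
have rho1 : rho < 1.
  rewrite /rho -ltr_pdivlMr// mul1r -[ltRHS]lnK ?posrE ?invr_gt0//.
  by rewrite ltr_expR.
(* [D * rho ^+ k] dominates the weighted distance for [t] between [t1 + k%:R * T] and one period
   later, whence the extra [T] in the exponent. *)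
pose t1 := tG + c; pose D := expR (xi * (t1 + T)) * (L * r).
have D0 : 0 <= D by rewrite !mulr_ge0 ?expR_ge0// ltW.
apply: cvge0_of_le => [t|e e0].
  by apply: mule_ge0; [rewrite lee_fin expR_ge0|exact: semidist_ge0].
have : rho ^+ k @[k --> \oo] --> 0.
  by apply: cvg_expr; rewrite ger0_norm// ltW.
(* [D] vanishes when [L = 0], so the division is by [D + 1]. *)
have D1 : 0 < D + 1 by rewrite ltr_wpDl.
move=> /cvgrPdist_lt/(_ (e / (D + 1))); rewrite divr_gt0// => /(_ isT)[N _ NP].
exists (t1 + (maxn N k0)%:R * T) => t tt.
have [|k kt tk] := @real_period_itv R T (t - t1) T_gt0.
  by rewrite subr_ge0; apply: le_trans tt; rewrite lerDl.
have : (maxn N k0 <= k)%N.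
  rewrite -ltnS -(ltr_nat R) -(ltr_pM2r T_gt0) -natr1 mulrDl mul1r.
  by apply: le_lt_trans tk; rewrite lerBrDl.
rewrite geq_max => /andP[Nk k0k].
have Lq : 0 <= L * (r * q ^+ k) by rewrite !mulr_ge0 ?exprn_ge0// ltW.
have tM : (semidist (S t @` G) M <= (L * (r * q ^+ k))%:E)%E.
  apply: semidist_le => // _ [x Gx <-].
  have sG : tG <= t - (c + k%:R * T) by rewrite /t1 in kt; lra.
  have Py : P (S (t - (c + k%:R * T)) x) by apply: (tGP _ sG); exists x.
  have [y Ey] := flow_near k0k Py.
  rewrite -semigroupD//; [|exact: addr_ge0|exact: le_trans sG].
  by rewrite subrKC; exists y => //; exact: EM.
apply: (@le_trans _ _ ((expR (xi * t))%:E * (L * (r * q ^+ k))%:E)%E).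
  by apply: lee_wpmul2l => //; rewrite lee_fin expR_ge0.
rewrite -EFinM lee_fin; apply: (@le_trans _ _ (D * rho ^+ k)).
  have tu : t <= t1 + T + k%:R * T by lra.
  rewrite (_ : D * _ = expR (xi * (t1 + T + k%:R * T)) * (L * (r * q ^+ k))).
    by rewrite ler_wpM2r// ler_expR ler_pM2l.
  by rewrite mulrDr [xi * (k%:R * T)]mulrCA expRD expRM_natl /D /rho exprMn; ring.
have rhok : 0 <= rho ^+ k by rewrite exprn_ge0// ltW.
have := NP _ Nk; rewrite /= sub0r normrN ger0_norm// ltr_pdivlMr// => /ltW.
by apply: le_trans; rewrite mulrC ler_wpM2l// lerDl.
Qed.

(** * The global attractor and its relation to the skeleton *)

Hypotheses (P_bounded : mbounded P) (P_abs : absorbing S P).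
Hypothesis S_closed : asymptotically_closed S.

Let attr := omega_limit S P.

Lemma skeleton_attractor : global_attractor S attr.
Proof.
apply: omega_limit_global_attractor => //; exact: skeleton_totally_bounded.
Qed.

Let attr_inv t : 0 <= t -> S t @` attr = attr.
Proof. by have [_ _ inv _] := skeleton_attractor; exact: inv. Qed.

Let attr_image t : 0 <= t -> attr `<=` S t @` P.
Proof.
have [_ attr_compact _ _] := skeleton_attractor.
apply: invariant_sub_absorbing => //.
have [s [s0 sP]] := P_abs P_bounded.
apply: mboundedS (mbounded_closure P_bounded) => x /(_ s s0).
by apply: closure_subset => y [u su] /(sP _ su).
Qed.

Lemma attractor_sub : attr `<=` P.
Proof. by apply: subset_trans (attr_image (lexx 0)) _; exact: P_inv. Qed.

Lemma attractor_sub_closure_skeleton : attr `<=` closure E0.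
Proof.
move=> x Ax U; rewrite -nbhs_ballE => -[e /= e0 xeU].
have [k k0k rqk] := radius_cvg0 e0.
have [w Ww wx] := W_cover k0k (attr_image (kT_ge0 k) Ax).
exists w; split; first exact: skeleton_union_net Ww.
by apply: xeU; apply: ball_sym; apply: le_ball wx; exact: ltW.
Qed.

Lemma omega_limit_closure_skeleton : omega_limit S (closure E0) = attr.
Proof.
(* Left to right, [closure E0] is bounded and enters [P] after a time [u], so times beyond [s + u]
   leave at least [s] for [P]. Right to left, the attractor is its own image under [S s] and lies in
   [closure E0]. *)
apply/seteqP; split=> [x Ex s s0|x Ax s s0].
  have clE0 : mbounded (closure E0).
    apply: mbounded_closure; apply: mboundedS P_bounded.
    exact: skeleton_union_sub.
  have [u [u0 uP]] := P_abs clE0.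
  have : closure (\bigcup_(t in [set t | s + u <= t]) S t @` closure E0) x.
    by apply: Ex; exact: addr_ge0.
  apply: closure_subset => _ [t /= sut [y Ey <-]].
  exists (t - u); first by rewrite /= lerBrDr.
  exists (S u y); first by apply: (uP u) => //; exists y.
  by rewrite -semigroupD// ?subrK// subr_ge0; apply: le_trans sut; rewrite lerDr.
apply: subset_closure; have : (S s @` attr) x by rewrite attr_inv.
move=> [y Ay <-]; exists s; first exact: lexx.
by exists y => //; exact: attractor_sub_closure_skeleton.
Qed.

(** * Hölder continuity in time: closure, compactness and dimension *)

Variables eps0 zeta nu : R.
Hypotheses (eps0_gt0 : 0 < eps0) (zeta_gt0 : 0 < zeta) (nu_gt0 : 0 < nu).
Hypothesis S_holder : forall t t' x, c <= t -> c <= t' -> `|t - t'| <= eps0 ->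
  P x -> mdist (S t x) (S t' x) <= zeta * `|t - t'| `^ nu.

Lemma holder_modulus e : 0 < e ->
  exists d : R, [/\ 0 < d, d <= eps0 & zeta * d `^ nu < e].
Proof.
move=> e0; have ez : 0 < e / (2 * zeta) by rewrite divr_gt0 ?mulr_gt0.
have ez0 : 0 < (e / (2 * zeta)) `^ nu^-1 by rewrite powR_gt0.
exists (Num.min eps0 ((e / (2 * zeta)) `^ nu^-1)); split.
- by rewrite lt_min eps0_gt0.
- by rewrite ge_min lexx.
apply: (@le_lt_trans _ _ (e / 2)); last by rewrite gtr_pMr// invf_lt1// ltr1n.
rewrite mulrC -ler_pdivlMr// -mulrA -invfM.
have ezE : ((e / (2 * zeta)) `^ nu^-1) `^ nu = e / (2 * zeta).
  by rewrite -powRrM mulVf ?gt_eqF// powRr1// ltW.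
rewrite -[leRHS]ezE; apply: ge0_ler_powR; rewrite ?nnegrE ?(ltW nu_gt0)//.
- by rewrite le_min (ltW eps0_gt0) ltW.
- exact: ltW.
- by rewrite ge_min lexx orbT.
Qed.

Lemma holder_lt t t' x d e : c <= t -> c <= t' -> `|t - t'| <= d -> d <= eps0 ->
  zeta * d `^ nu < e -> P x -> mdist (S t x) (S t' x) < e.
Proof.
move=> ct ct' ttd de ze Px; apply: le_lt_trans ze.
apply: le_trans (S_holder ct ct' (le_trans ttd de) Px) _.
rewrite ler_pM2l//; apply: ge0_ler_powR; rewrite ?nnegrE ?(ltW nu_gt0)//.
exact: le_trans ttd.
Qed.

Lemma orbit_segment_closed x : P x -> closed ((fun t => S t x) @` `[c, c + T]).
Proof.
move=> Px; apply: compact_closed; first exact: metric_hausdorff.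
apply: continuous_compact; last exact: segment_compact.
apply/subspace_continuousP => t /=; rewrite in_itv/= => /andP[ct _].
apply/cvg_ballP => e e0; have [d [d0 de ze]] := holder_modulus e0.
rewrite near_withinE; near=> t'.
have ttd : `|t - t'| < d.
  by near: t'; apply: (@cvgr_dist_lt _ _ _ (nbhs t) _ id t _ d d0); exact: cvg_id.
rewrite /= in_itv/= => /andP[ct' _].
by rewrite ballEmdist/=; apply: holder_lt de ze Px => //; exact: ltW.
Unshelve. all: by end_near. Qed.

Let F j := \bigcup_(t in `[c, c + T]) S t @` \bigcup_(i in `I_j) Q i.

(** The first levels are finite, so [F j] is a finite union of orbit segments, each the continuous
    image of a compact interval. *)
Lemma flow_prefix_closed j : closed (F j).
Proof.
have [A QA _] := skeleton_prefix_finite j.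
have AP : [set` A] `<=` P.
  by rewrite -QA => x [i _ Qx]; apply: skeleton_union_sub; exists i.
rewrite /F QA (_ : \bigcup_(t in _) _ =
    \bigcup_(x in [set` A]) ((fun t => S t x) @` `[c, c + T])).
  rewrite bigcup_fset; apply: closed_bigsetU => x xA.
  by apply: orbit_segment_closed; exact: AP.
by apply/seteqP; split=> [_ [t ct [x xA <-]]|_ [x xA [t ct <-]]];
  [exists x => //; exists t|exists t => //; exists x].
Qed.

Lemma flow_split j : E `<=` F j `|` S ((k0 + j)%N%:R * T) @` P.
Proof.
move=> _ [t ct [x /(@skeleton_union_split j)[Qx|[z Pz <-]] <-]].
  by left; exists t => //; exists x.
have t0 : 0 <= t.
  by move: ct; rewrite /= in_itv/= => /andP[ct _]; exact: le_trans ct.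
right; exists (S t z); first by apply: (P_inv t0); exists z.
by rewrite -!semigroupD// addrC.
Qed.

(** Since [F j] is closed and contained in [E], a limit point outside [E] comes from the other half
    of [flow_split], for every [j]; letting [j] grow puts it in the omega-limit set. *)
Lemma flow_closure : closure E = attr `|` E.
Proof.
apply/seteqP; split=> [y Ey|y [|]]; last first.
- exact: subset_closure.
- apply: invariant_sub_closure_flow; first exact: attractor_sub.
  exact: attr_inv.
have [?|nE] := pselect (E y); [by right|left => s s0].
pose j := (Num.truncn (s / T)).+1.
have sj : s <= (k0 + j)%N%:R * T.
  rewrite -ler_pdivrMr//; have sT : 0 <= s / T by rewrite divr_ge0// ltW.
  have /andP[_ /ltW sj] := truncn_itv sT; apply: le_trans sj _.
  by rewrite ler_nat leq_addl.
have := closure_subset (@flow_split j) Ey.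
rewrite closureU -((closure_id (F j)).1 (@flow_prefix_closed j)).
case=> [[t ct [x [i _ Qx] Sx]]|].
  by case: nE; exists t => //; exists x => //; exists i.
by apply: closure_subset => z Pz; exists ((k0 + j)%N%:R * T).
Qed.

(** Centers are the orbit points at times [c + i%:R * d]; each time of the interval exceeds one of
    these by less than [d]. *)
Lemma flow_segment_cover (A : {fset V}) d e : [set` A] `<=` P -> 0 < d ->
  d <= eps0 -> zeta * d `^ nu < e ->
  exists A' : {fset V}, #|` A'|%:R <= (T / d + 1) * #|` A|%:R /\
    \bigcup_(t in `[c, c + T]) S t @` [set` A]
      `<=` \bigcup_(x in [set` A']) ball x e.
Proof.
move=> AP d0 de ze; have Td : 0 <= T / d by rewrite divr_ge0// ltW.
pose m := (Num.truncn (T / d)).+1.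
pose s := [seq S (c + i%:R * d) x | i <- iota 0 m, x <- enum_fset A].
exists (seq_fset tt s); split.
  apply: (@le_trans _ _ (m%:R * #|` A|%:R)).
    rewrite -natrM ler_nat size_seq_fset; apply: leq_trans (size_undup _) _.
    by rewrite size_allpairs size_iota.
  apply: ler_wpM2r => //; rewrite /m -natr1 lerD2r.
  by have /andP[] := truncn_itv Td.
move=> _ [t /=] /[!in_itv]/= /andP[ct tcT] [x xA <-].
have [|i it ti] := @real_period_itv R d (t - c) d0; first by rewrite subr_ge0.
have im : (i < m)%N.
  have /andP[_] := truncn_itv Td; rewrite -/m ltr_pdivrMr// => Tm.
  rewrite -(ltr_nat R) -(ltr_pM2r d0); apply: le_lt_trans it _.
  by apply: le_lt_trans Tm; rewrite lerBlDl.
exists (S (c + i%:R * d) x).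
  suff : S (c + i%:R * d) x \in seq_fset tt s by [].
  rewrite seq_fsetE; apply/allpairsP; exists (i, x); split=> //.
  by rewrite mem_iota add0n.
rewrite ballEmdist/=; apply: holder_lt de ze (AP _ xA) => //.
  by rewrite lerDl mulr_ge0// ltW.
by rewrite ler_norml; apply/andP; split; lra.
Qed.

Lemma flow_cover : exists2 C : R, 0 < C & forall j, exists A : {fset V},
  #|` A|%:R <= C * j.+1%:R ^+ 2 * (h / q `^ nu^-1) ^+ j /\
  E `<=` \bigcup_(x in [set` A]) ball x (r * q ^+ k0 * q ^+ j).
Proof.
set p := q `^ nu^-1.
have p0 : 0 < p by rewrite powR_gt0.
have p1 : p <= 1. by apply: powR_le1; rewrite ?invr_ge0 ltW.
have pnu : p `^ nu = q by rewrite -powRrM mulVf ?gt_eqF// powRr1// ltW.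
have rq0 : 0 < r * q ^+ k0 by rewrite mulr_gt0 ?exprn_gt0.
have [kap [kap0 kape kapz]] := holder_modulus rq0.
have h0 : 0 < h by apply: lt_le_trans h_ge1.
have Tk0 : 0 < T / kap by rewrite divr_gt0.
(* The samples give [T / (kap * p ^+ j) + 1] times the count [Y] and the net [W (k0 + j)] at most
   another [Y]; [p ^+ j <= 1] lets the factor [(p ^+ j)^-1] be pulled out. *)
exists ((T / kap + 2) * (b * h ^+ k0)).
  by rewrite !mulr_gt0 ?exprn_gt0// addr_gt0.
move=> j; have pj0 : 0 < p ^+ j by rewrite exprn_gt0.
have pj1 : p ^+ j <= 1 by rewrite exprn_ile1 ?(ltW p0).
have [A QA cA] := skeleton_prefix_finite j.
have AP : [set` A] `<=` P.
  by rewrite -QA => x [i _ Qx]; apply: skeleton_union_sub; exists i.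
have [|||A' [cA' AA']] :=
    @flow_segment_cover A (kap * p ^+ j) (r * q ^+ k0 * q ^+ j) AP.
- by rewrite mulr_gt0.
- by apply: le_trans kape; rewrite ger_pMr.
- rewrite powRM ?(ltW kap0) ?(ltW pj0)// -powR_mulrn ?(ltW p0)// -powRrM.
  rewrite [j%:R * nu]mulrC powRrM pnu powR_mulrn ?(ltW q_gt0)// mulrA.
  by rewrite ltr_pM2r ?exprn_gt0.
exists (A' `|` W (k0 + j))%fset; split; last first.
  move=> y /(@flow_split j)[|].
    rewrite /F QA => /AA'[x xA xy].
    by exists x => //=; rewrite inE; apply/orP; left.
  move=> /(W_cover (leq_addr j k0))[x xW xy].
  by exists x; [rewrite /= inE; apply/orP; right|rewrite -mulrA -exprD].
apply: (@le_trans _ _ (#|` A'|%:R + #|` W (k0 + j)|%:R)).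
  by rewrite -natrD ler_nat leq_card_fsetU.
set Y := b * j.+1%:R ^+ 2 * h ^+ (k0 + j).
have Y0 : 0 < Y by rewrite !mulr_gt0 ?exprn_gt0.
have cW : #|` W (k0 + j)|%:R <= Y.
  apply: le_trans (W_card (leq_addr _ _)) _; rewrite /Y mulrAC ler_peMr//.
    by rewrite mulr_ge0 ?exprn_ge0// ltW.
  by rewrite exprn_ege1// ler1n.
have pVj : 1 <= (p ^+ j)^-1 by rewrite invf_ge1.
have {}cA' : #|` A'|%:R <= (T / kap * (p ^+ j)^-1 + 1) * Y.
  apply: le_trans cA' _; rewrite invfM mulrA ler_wpM2l//.
  by rewrite addr_ge0// mulr_ge0 ?ltW// invr_gt0.
apply: le_trans (lerD cA' cW) _.
rewrite (_ : (T / kap + 2) * _ * _ * _ = (T / kap + 2) * (p ^+ j)^-1 * Y); last first.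
  by rewrite /Y exprMn exprVn exprD; ring.
rewrite -[X in _ + X]mul1r -mulrDl ler_wpM2r ?(ltW Y0)//; lra.
Qed.

Lemma flow_closure_compact : compact (closure E).
Proof.
have [C _ EC] := flow_cover; apply: totally_bounded_compact => e.
move=> /radius_cvg0[k k0k rqk]; have [A [_ EA]] := EC (k - k0)%N.
exists A; apply: subset_trans EA _ => y [x xA xy]; exists x => //.
by apply: le_ball xy; rewrite -mulrA -exprD subnKC// ltW.
Qed.

Lemma flow_closure_fractal_dim :
  (fractal_dim (closure E) <= (nu^-1 + ln h / ln q^-1)%:E)%E.
Proof.
have [C C0 EC] := flow_cover.
have h0 : 0 < h by apply: lt_le_trans h_ge1.
have p0 : 0 < q `^ nu^-1 by rewrite powR_gt0.
have p1 : q `^ nu^-1 <= 1. by apply: powR_le1; rewrite ?invr_ge0 ltW.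
have lnq : ln q < 0 by rewrite ln_lt0// q_gt0.
have -> : nu^-1 + ln h / ln q^-1 = ln (h / q `^ nu^-1) / ln q^-1.
  rewrite ln_div ?posrE// ln_powR lnV ?posrE//.
  by field; rewrite lt_eqF// gt_eqF.
(* The radius is doubled to pass from [E] to its closure with the same centers. *)
apply: (@fractal_dim_le _ _ _ (2 * (r * q ^+ k0)) _ C) => //.
- by rewrite !mulr_gt0 ?exprn_gt0.
- rewrite ler_pdivlMr// mul1r; exact: le_trans h_ge1.
move=> j; have [A [cA EA]] := EC j; exists A; split=> //.
apply: cover_closure EA; rewrite -[ltRHS]mulrA ltr_pMl ?ltr1n//.
by rewrite !mulr_gt0 ?exprn_gt0.
Qed.

End flow.
End skeleton_theory.

(** * The reduced absorbing set and existence of a skeleton *)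

Section reduced_absorbing_set.
Context {R : realType} {V : completeMetricType R}.
Variables (S : R -> V -> V) (B : set V).
Hypotheses (S_sg : semigroup S) (B_absorbing : absorbing S B).

Lemma reduced_absorbing_exists : mbounded B -> exists B', reduced_absorbing S B B'.
Proof.
move=> /B_absorbing[tB [tB0 tBP]].
(* A positively invariant [B] must be kept as it is; then [tB = 0] presents it as the required
   union, because [S 0] is the identity. *)
have [inv|ninv] := pselect (positively_invariant S B); last first.
  exists (\bigcup_(t in [set t | tB <= t]) S t @` B).
  by split; [exists tB|move=> /ninv].
exists B; split=> //; exists 0; split=> //; apply/seteqP; split=> [x Bx|x].
  by exists 0; [exact: lexx|exists x => //; exact: semigroup0].
by move=> [t t0]; exact: inv.
Qed.

Lemma reduced_absorbing_sub B' : reduced_absorbing S B B' -> B' `<=` B.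
Proof. by move=> [[tB [_ tBP ->]] _] x [t /tBP]; apply. Qed.

Lemma reduced_absorbing_invariant B' :
  reduced_absorbing S B B' -> positively_invariant S B'.
Proof.
move=> [[tB [tB0 _ ->]] _] s s0 _ [_ [t /= tBt [x Bx <-]] <-].
exists (s + t); first by rewrite /= -[leLHS]add0r lerD.
by exists x => //; rewrite semigroupD//; exact: le_trans tBt.
Qed.

Lemma reduced_absorbing_absorbing B' : reduced_absorbing S B B' -> absorbing S B'.
Proof.
move=> [[tB [tB0 _ ->]] _] G /B_absorbing[t [t0 tP]].
exists (tB + t); split=> [|s st _ [x Gx <-]]; first exact: addr_ge0.
exists tB; first exact: lexx.
exists (S (s - tB) x).
  by apply: (tP (s - tB)); [rewrite lerBrDl|exists x].
by rewrite -semigroupD// ?subrKC// subr_ge0; apply: le_trans st; rewrite lerDl.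
Qed.

(** The covers given are of images of [B]; recentering them in the images of the subset [B'] doubles
    the radius, so [2 * a] serves as the larger constant. *)
Lemma is_E0_exists (T : R) (k0 : nat) (q a b h : R) : mbounded B -> 0 < a ->
  (forall k, (k0 <= k)%N ->
    (cover_num (S (k%:R * T)%R @` B) (a * q ^+ k)%R <= (b * h ^+ k)%:E)%E) ->
  exists E0, is_E0 S B T k0 q a b h E0.
Proof.
move=> B_bounded a0 cov; have [B' B'P] := reduced_absorbing_exists B_bounded.
have /choice[W WP] k : exists A : {fset V}, (k0 <= k)%N ->
    [/\ [set` A] `<=` S (k%:R * T) @` B', #|` A|%:R <= b * h ^+ k &
      S (k%:R * T) @` B' `<=` \bigcup_(x in [set` A]) ball x (2 * a * q ^+ k)].
  have [k0k|kk0] := leqP k0 k; last by exists fset0.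
  have [A [_ cA BA]] := cover_num_attained (cov _ k0k).
  have [|A' [A'B cA' BA']] :=
      @recenter_cover _ _ (S (k%:R * T) @` B') A (a * q ^+ k).
    by apply: subset_trans BA; apply: image_subset; exact: reduced_absorbing_sub.
  exists A' => _; split=> //; last by rewrite -mulrA.
  by apply: le_trans cA; rewrite ler_nat.
exists (\bigcup_j skeleton S T k0 W j), B', (2 * a), W; split=> //.
by rewrite ler_peMl ?ler1n// ltW.
Qed.

End reduced_absorbing_set.

(** * Assembly of the exponential attractor *)

Theorem theorem9p1 (R : realType) (V : completeMetricType R)
    (S : R -> V -> V) (B : set V) (T : R) (k0 : nat) (q a b h T1 : R)
    (S_semigroup : semigroup S) (S_closed : asymptotically_closed S)
    (B_bounded : mbounded B) (B_absorbing : absorbing S B)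
    (T_gt0 : 0 < T) (k0_gt0 : (0 < k0)%N) (q_gt0 : 0 < q) (q_lt1 : q < 1)
    (a_gt0 : 0 < a) (b_gt0 : 0 < b) (h_ge1 : 1 <= h)
    (covering : forall k, (k0 <= k)%N ->
      (cover_num (S (k%:R * T)%R @` B) (a * q ^+ k)%R <= (b * h ^+ k)%:E)%E)
    (T1_ge0 : 0 <= T1)
    (lipschitz : 0 < T1 -> exists (N : nat) (L : R),
      [/\ (0 < N)%N, T1 <= N%:R * T, 0 <= L &
        forall x y, B x -> B y ->
          mdist (S (N%:R * T) x) (S (N%:R * T) y) <= L * mdist x y]) :
  (exists E0, is_E0 S B T k0 q a b h E0) /\
  forall E0, is_E0 S B T k0 q a b h E0 ->
  exists (M : set V) (c d : R), [/\ 0 <= c, c <= d &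
    forall T2 zeta nu : R, T1 < T2 -> 0 < zeta -> 0 < nu ->
      (forall t1 t2 x, T1 <= t1 <= T2 -> T1 <= t2 <= T2 -> B x ->
        mdist (S t1 x) (S t2 x) <= zeta * `|t1 - t2| `^ nu) ->
    let E := \bigcup_(t in `[c, d]) S t @` E0 in
    let A := omega_limit S (closure E0) in
    [/\ exponential_attractor S M,
        (forall xi, 0 < xi -> xi < T^-1 * ln q^-1 -> attracts_at_rate S M xi),
        (fractal_dim M <= (nu^-1 + ln h / ln q^-1)%:E)%E,
        global_attractor S A &
        [/\ M = A `|` E, M = closure E, M `<=` B, E `<=` B &
            E0 `<=` B /\ countable E0]]].
Proof.
split; first exact: is_E0_exists covering.
move=> _ [B' [r [W [B'P ar WP ->]]]].
have r_gt0 : 0 < r by apply: lt_le_trans ar.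
have B'B := reduced_absorbing_sub B'P.
have B'_inv := reduced_absorbing_invariant S_semigroup B'P.
have B'_abs := reduced_absorbing_absorbing S_semigroup B_absorbing B'P.
have B'_bounded : mbounded B' by exact: mboundedS B_bounded.
have W_sub k : (k0 <= k)%N -> [set` W k] `<=` S (k%:R * T) @` B'.
  by move=> /WP[].
have W_card k : (k0 <= k)%N -> #|` W k|%:R <= b * h ^+ k by move=> /WP[].
have W_cover k : (k0 <= k)%N -> S (k%:R * T) @` B' `<=`
    \bigcup_(x in [set` W k]) ball x (r * q ^+ k) by move=> /WP[].
(* When [T1 = 0] the choice [N = 0] and [L = 1] works, [S 0] being the identity. *)
have [N [L [T1N L_ge0 S_lip]]] : exists (N : nat) (L : R),
    [/\ T1 <= N%:R * T, 0 <= L & forall x y, B' x -> B' y ->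
      mdist (S (N%:R * T) x) (S (N%:R * T) y) <= L * mdist x y].
  have [T1_gt0|T1_le0] := ltP 0 T1.
    have [N [L [_ T1N L0 SL]]] := lipschitz T1_gt0.
    by exists N, L; split=> // x y /B'B Bx /B'B By; exact: SL.
  exists 0%N, 1; rewrite mul0r; split=> // x y _ _.
  by rewrite !semigroup0// mul1r.
set c := N%:R * T in T1N S_lip.
have c_ge0 : 0 <= c by apply: le_trans T1N.
set E0 := \bigcup_j _.
(* The set and the interval are fixed before [T2], [zeta] and [nu] appear, which expresses
   independence of them. *)
exists (closure (\bigcup_(t in `[c, c + T]) S t @` E0)), c, (c + T).
split=> //; first by rewrite lerDl ltW.
move=> T2 zeta nu T12 zeta_gt0 nu_gt0 S_hol; cbv zeta.
set E := \bigcup_(t in `[c, c + T]) S t @` E0.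
have eps0 : 0 < T2 - T1 by rewrite subr_gt0.
(* The estimate on [[T1, T2]] extends to all later times for increments up to [T2 - T1]: the point
   is first advanced by [t - T1], staying in [B']. *)
have S_holder t t' x : c <= t -> c <= t' -> `|t - t'| <= T2 - T1 -> B' x ->
    mdist (S t x) (S t' x) <= zeta * `|t - t'| `^ nu.
  wlog tt' : t t' / t <= t' => [hw ct ct' d B'x|ct _ d B'x].
    have [/hw|/ltW t't] := leP t t'; first exact.
    by rewrite metric_sym distrC; apply: hw; rewrite // distrC.
  have T1t : T1 <= t by apply: le_trans ct.
  have By : B (S (t - T1) x).
    by apply: B'B; apply: (B'_inv (t - T1)); [rewrite subr_ge0|exists x].
  rewrite ler0_norm ?subr_le0// opprB in d *.
  have d0 : 0 <= t' - t by rewrite subr_ge0.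
  have tT1 : 0 <= t - T1 by rewrite subr_ge0.
  have St : S t x = S T1 (S (t - T1) x).
    by rewrite -(semigroupD S_semigroup)// subrKC.
  have St' : S t' x = S (T1 + (t' - t)) (S (t - T1) x).
    have t'E : T1 + (t' - t) + (t - T1) = t' by ring.
    by rewrite -(semigroupD S_semigroup) ?t'E// addr_ge0.
  have dE : t' - t = `|T1 - (T1 + (t' - t))|.
    by rewrite opprD addNKr normrN ger0_norm.
  rewrite St St' [in leRHS]dE; apply: S_hol => //.
    by rewrite lexx ltW.
  by rewrite lerDl d0 -lerBrDl.
have A_eq : omega_limit S (closure E0) = omega_limit S B'.
  exact: (omega_limit_closure_skeleton S_semigroup B'_inv T_gt0 q_gt0 q_lt1
    r_gt0 W_sub W_cover).
have A_attr : global_attractor S (omega_limit S B').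
  exact: (skeleton_attractor S_semigroup T_gt0 q_gt0 q_lt1 r_gt0 W_cover).
have [A_nonempty _ A_inv _] := A_attr.
have cl_eq : closure E = omega_limit S B' `|` E.
  exact: (flow_closure S_semigroup B'_inv T_gt0 q_gt0 q_lt1 r_gt0 b_gt0 h_ge1
    W_sub W_card W_cover c_ge0 L_ge0 S_lip B'_bounded B'_abs S_closed
    eps0 zeta_gt0 nu_gt0 S_holder).
have EB' : E `<=` B'.
  exact: (flow_sub S_semigroup B'_inv T_gt0 W_sub c_ge0).
have AB' : omega_limit S B' `<=` B'.
  exact: (attractor_sub S_semigroup B'_inv T_gt0 q_gt0 q_lt1 r_gt0 W_cover).
have rate xi : 0 < xi -> xi < T^-1 * ln q^-1 -> attracts_at_rate S (closure E) xi.
  by apply: (flow_attracts S_semigroup B'_inv T_gt0 q_gt0 r_gt0 W_sub W_cover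
    c_ge0 L_ge0 S_lip B'_abs); exact: subset_closure.
have dim : (fractal_dim (closure E) <= (nu^-1 + ln h / ln q^-1)%:E)%E.
  exact: (flow_closure_fractal_dim S_semigroup B'_inv T_gt0 q_gt0 q_lt1 r_gt0
    b_gt0 h_ge1 W_sub W_card W_cover c_ge0 eps0 zeta_gt0 nu_gt0 S_holder).
rewrite A_eq; split=> //.
- split.
  + by have [x Ax] := A_nonempty; exists x; rewrite cl_eq; left.
  + exact: (flow_closure_compact S_semigroup B'_inv T_gt0 q_gt0 q_lt1 r_gt0
      b_gt0 h_ge1 W_sub W_card W_cover c_ge0 eps0 zeta_gt0 nu_gt0 S_holder).
  (* Without continuity of [S t], invariance of the closure is read off from its two pieces [A] and
     [E]. *)
  + move=> t t0; rewrite cl_eq image_setU A_inv//; apply: setUS.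
    exact: (flow_positively_invariant S_semigroup T_gt0 c_ge0).
  + exact: le_lt_trans dim (ltry _).
  + have lim_gt0 : 0 < T^-1 * ln q^-1.
      by rewrite mulr_gt0 ?invr_gt0// ln_gt0// invf_gt1.
    exists (T^-1 * ln q^-1 / 2); split; first by rewrite divr_gt0.
    apply: rate; first by rewrite divr_gt0.
    by rewrite gtr_pMr// invf_lt1// ltr1n.
- split=> //.
  + by rewrite cl_eq => x [/AB'|/EB'] /B'B.
  + by move=> x /EB' /B'B.
  + split; last exact: (skeleton_union_countable _ _ b_gt0 h_ge1 W_card).
    by move=> x /(skeleton_union_sub S_semigroup B'_inv T_gt0 W_sub)/B'B.
Qed.
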